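(* (a) There is no finite extraspecial $2$-group $G$ with $\alpha(G)=\frac{3}{4}$. (b) Every finite almost extraspecial $2$-group $G$ satisfies $\alpha(G)=\frac{3}{4}$.
   Context: For a finite group $G$, $L_1(G)$ denotes the set (poset) of cyclic subgroups of $G$ (including the trivial subgroup), and $\alpha(G)=\frac{|L_1(G)|}{|G|}$. A finite $2$-group $G$ is called extraspecial if $G'=\Phi(G)=Z(G)\cong\mathbb{Z}_2$, and almost extraspecial if $G'=\Phi(G)\cong\mathbb{Z}_2$ and $Z(G)\cong\mathbb{Z}_4$. Here $G'$ is the derived subgroup, $\Phi(G)$ the Frattini subgroup, $Z(G)$ the center, and $\mathbb{Z}_m$ the cyclic group of order $m$. *)

(* Defs.v *)
From mathcomp Require Import all_boot all_order all_algebra.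
From mathcomp Require Import all_fingroup all_solvable.

Set Implicit Arguments.
Unset Strict Implicit.
Unset Printing Implicit Defensive.

Local Open Scope group_scope.

Section Defs.

Variable gT : finGroupType.
Implicit Type G : {group gT}.

Definition L1 G : {set {group gT}} := [set H in subgroups G | cyclic H].

Definition alpha G : rat := (#|L1 G|%:R / #|G|%:R)%R.

(* MathComp's [extraspecial] only asks that 'Z(G) have prime order; for a
   2-group this amounts to 'Z(G) being cyclic of order 2, as shown by
   [extraspecial2P] below. *)
Definition extraspecial2 G : Prop := 2.-group G /\ extraspecial G.

Definition almost_extraspecial2 G : Prop :=
  [/\ 2.-group G, G^`(1) = 'Phi(G), 'Phi(G) \isog Zp 2 & 'Z(G) \isog Zp 4].

Lemma extraspecial2P G :
  extraspecial2 G <->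
  [/\ 2.-group G, G^`(1) = 'Phi(G), 'Phi(G) = 'Z(G) & 'Z(G) \isog Zp 2].
Proof.
split=> [[pG esG] | [pG dG PG iZ]].
  have [[PG dG] _] := esG; split=> //; first by rewrite dG PG.
  have oZ := card_center_extraspecial pG esG.
  rewrite isog_cyclic_card ?oZ ?card_Zp //; last by rewrite prime_cyclic ?oZ.
  by rewrite eqxx andbT; apply/cyclicP; exists Zp1; exact: Zp_cycle.
split=> //; split; first by split; rewrite ?dG.
by rewrite (card_isog iZ) card_Zp.
Qed.

End Defs.

(* Main.v *)
Require Import Defs.
From mathcomp Require Import all_boot all_order all_algebra.
From mathcomp Require Import all_fingroup all_solvable.
From mathcomp Require Import zify.

(** Both parts are statements about the number of solutions of [x ^+ 2 = 1].
    Let [G] be a 2-group whose Frattini subgroup has order 2, and give [x] the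
    sign +1 or -1 according to whether [x ^+ 2 = 1] or not.  As [x ^+ 4 = 1]
    throughout [G], each cyclic subgroup has order 1, 2 or 4, and counting
    generators yields [4 |L1 G| = 3 |G| + S(G)], where [S(A)] is the sum of the
    signs over [A] ([card_L1_square_sum]).  Hence [alpha G = 3/4] exactly when
    [S(G) = 0].

    The signs behave like the values of a quadratic form on the vector space
    [G / 'Phi(G)] over the field with two elements, whose polar form is the
    commutator.  Squaring [S(G)] as one squares a quadratic Gauss sum gives
    [S(G)^2 = |G| S('Z(G))] ([square_sum_sqr]), so only the centre matters.  For
    a centre of order 2 all signs are +1 and [S('Z(G)) = 2]; for a cyclic
    centre of order 4 translation by a generator flips the sign and
    [S('Z(G)) = 0]. *)

Set Implicit Arguments.
Unset Strict Implicit.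
Unset Printing Implicit Defensive.

Import GRing.Theory Num.Theory.
Local Open Scope group_scope.

Section SquareSums.

Variable gT : finGroupType.
Implicit Types (G A : {group gT}) (x y g : gT).

(** On a group of order 2 this is the nontrivial character. *)
Definition sign1 x : int := ((-1) ^+ (x != 1%g))%R.

Definition square_sum (A : {set gT}) : int :=
  (\sum_(x in A) sign1 (x ^+ 2))%R.

Lemma sign1_1 : sign1 1 = 1%R.
Proof. by rewrite /sign1 eqxx. Qed.

Lemma sign1_neq1 x : x != 1 -> sign1 x = (-1)%R.
Proof. by rewrite /sign1 => ->. Qed.

Lemma sign1_sqr x : (sign1 x * sign1 x = 1)%R.
Proof. by rewrite /sign1 -expr2 sqrr_sign. Qed.

Lemma card2_mul A x y :
  #|A| = 2 -> x \in A -> y \in A -> x != 1 -> y != 1 -> x * y = 1.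
Proof.
move=> oA Ax Ay nx ny.
have /cards1P[t defA] : #|A :\ 1| == 1%N.
  by move: oA; rewrite (cardsD1 1) group1 => -[/eqP].
have At u : u \in A -> u != 1 -> u = t.
  by move=> Au nu; apply/set1P; rewrite -defA !inE nu.
rewrite (At y) // -(At x) //; apply/eqP.
by rewrite -(expgS x 1) -order_dvdn -oA order_dvdG.
Qed.

Lemma sign1M A x y : #|A| = 2 -> x \in A -> y \in A ->
  sign1 (x * y) = (sign1 x * sign1 y)%R.
Proof.
move=> oA Ax Ay.
have [-> | nx] := eqVneq x 1; first by rewrite mul1g sign1_1 mul1r.
have [-> | ny] := eqVneq y 1; first by rewrite mulg1 sign1_1 mulr1.
by rewrite (card2_mul oA Ax Ay) // sign1_1 !sign1_neq1.
Qed.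

Lemma sum_mulgl G g (f : gT -> int) : g \in G ->
  (\sum_(x in G) f (g * x)%g = \sum_(x in G) f x)%R.
Proof.
move=> Gg; rewrite [RHS](reindex_inj (mulgI g)) /=.
by apply: eq_bigl => x; rewrite groupMl.
Qed.

Lemma sum_flip_eq0 G g (f : gT -> int) : g \in G ->
  {in G, forall x, f (g * x)%g = - f x}%R -> (\sum_(x in G) f x = 0)%R.
Proof.
move=> Gg fN; have := sum_mulgl f Gg.
by rewrite (eq_bigr _ fN) sumrN => /eqP; rewrite eqNr => /eqP.
Qed.

Section FrattiniOrder2.

Variable G : {group gT}.
Hypotheses (pG : 2.-group G) (oPhi : #|'Phi(G)| = 2).

Lemma sqr_in_Phi x : x \in G -> x ^+ 2 \in 'Phi(G).
Proof.
move=> Gx; rewrite (Phi_joing pG) (subsetP (joing_subr _ _)) //.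
exact: (Mho_p_elt 1 Gx (mem_p_elt pG Gx)).
Qed.

Lemma comm_in_Phi x y : x \in G -> y \in G -> [~ x, y] \in 'Phi(G).
Proof.
move=> Gx Gy; rewrite (Phi_joing pG) (subsetP (joing_subl _ _)) //.
by rewrite mem_commg.
Qed.

(** A normal subgroup of a nilpotent group meets the centre nontrivially, and
    here it has prime order. *)
Lemma Phi_sub_center : 'Phi(G) \subset 'Z(G).
Proof.
have ntPhi : 'Phi(G) != 1 by rewrite -cardG_gt1 oPhi.
have := meet_center_nil (pgroup_nil pG) (Phi_normal G) ntPhi.
by apply: contraR => nPZ; rewrite prime_TIg ?oPhi.
Qed.

Lemma Phi_commute x y : x \in 'Phi(G) -> y \in G -> commute x y.
Proof.
move=> Px Gy.
by have /centerP[_ cx] := subsetP Phi_sub_center x Px; apply: cx.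
Qed.

Lemma expg4_eq1 x : x \in G -> x ^+ 4 = 1.
Proof.
move=> /sqr_in_Phi Px2; apply/eqP.
by rewrite (expgM x 2 2) -order_dvdn (dvdn_trans (order_dvdG Px2)) ?oPhi.
Qed.

(** The commutator is the polar form of the square. *)
Lemma sign1_sqrM x y : x \in G -> y \in G ->
  sign1 ((x * y) ^+ 2) =
    (sign1 (x ^+ 2) * sign1 (y ^+ 2) * sign1 [~ y, x])%R.
Proof.
move=> Gx Gy; have Pyx := comm_in_Phi Gy Gx.
rewrite expMg_Rmul; last first.
- exact/commute_sym/Phi_commute.
- exact/commute_sym/Phi_commute.
have [Px2 Py2] := (sqr_in_Phi Gx, sqr_in_Phi Gy).
by rewrite binn expg1 (sign1M oPhi (groupM Px2 Py2)) // (sign1M oPhi Px2).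
Qed.

Lemma sign1_commM x y z : x \in G -> y \in G -> z \in G ->
  sign1 [~ x * y, z] = (sign1 [~ x, z] * sign1 [~ y, z])%R.
Proof.
move=> Gx Gy Gz; have Pxz := comm_in_Phi Gx Gz.
rewrite commMgJ conjgE (Phi_commute Pxz Gy) mulKg.
by rewrite (sign1M oPhi) ?comm_in_Phi.
Qed.

(** Orthogonality: [x |-> [~ x, y]] is a character of [G], trivial only for
    central [y]. *)
Lemma sum_sign1_comm y : y \in G ->
  (\sum_(x in G) sign1 [~ x, y] = if y \in 'Z(G) then #|G|%:Z else 0)%R.
Proof.
move=> Gy; case: ifPn => [/centerP[_ cy] | nZy].
  rewrite -sum1_card -natz natr_sum; apply: eq_bigr => x /cy cyx.
  by rewrite (eqP (introT commgP (commute_sym cyx))) sign1_1.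
have [g Gg ngy] : exists2 g, g \in G & [~ g, y] != 1.
  apply/exists_inP; apply: contraR nZy; rewrite negb_exists_in => /forall_inP cy.
  apply/centerP; split=> // g /cy; rewrite negbK => /commgP; exact: commute_sym.
apply: (sum_flip_eq0 Gg) => x Gx.
by rewrite sign1_commM // (sign1_neq1 ngy) mulN1r.
Qed.

(** The Gauss sum computation: substituting [x * y] for the second variable
    in [S(G) * S(G)] leaves the sum over [y] of [sign1 (y ^+ 2)], weighted by
    the sum over [x] of [sign1 [~ x, y]]. *)
Lemma square_sum_sqr :
  (square_sum G * square_sum G = #|G|%:Z * square_sum 'Z(G))%R.
Proof.
have comm_sym x y : sign1 [~ x, y] = sign1 [~ y, x].
  by rewrite /sign1 -invg_comm invg_eq1.
transitivity (\sum_(y in G) \sum_(x in G) sign1 (y ^+ 2)%g * sign1 [~ x, y]%g)%R.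
  rewrite exchange_big /= {1}/square_sum mulr_suml; apply: eq_bigr => x Gx.
  rewrite /square_sum -(sum_mulgl (fun t => sign1 (t ^+ 2)) Gx) mulr_sumr.
  apply: eq_bigr => y Gy.
  by rewrite sign1_sqrM // !mulrA sign1_sqr mul1r comm_sym.
rewrite /square_sum mulr_sumr [RHS]big_mkcond [LHS]big_mkcond /=.
apply: eq_bigr => y _; case: ifPn => Gy; last first.
  by rewrite ifN //; apply: contra Gy; apply: (subsetP (center_sub G)).
by rewrite -mulr_sumr sum_sign1_comm //; case: ifP; rewrite ?mulr0 // mulrC.
Qed.

(** The weight [3 + sign1 (x ^+ 2)] is 4 when [x] generates a subgroup of
    order 1 or 2, which has one generator, and 2 when [x] has order 4, where
    there are two generators: each cyclic subgroup contributes 4. *)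
Lemma card_L1_square_sum :
  (4 * #|L1 G|%:Z = 3 * #|G|%:Z + square_sum G)%R.
Proof.
have -> : (3 * #|G|%:Z + square_sum G =
           \sum_(x in G) (3 + sign1 (x ^+ 2)%g))%R.
  by rewrite big_split /= sumr_const -[(_ *+ #|_|)%R]mulr_natr [#|_|%:R%R]natz.
have cycL1 x : x \in G -> <[x]>%G \in L1 G.
  by move=> Gx; rewrite !inE cycle_subG Gx cycle_cyclic.
rewrite (partition_big (fun x => <[x]>%G) (mem (L1 G)) cycL1) /=.
rewrite -(natz #|L1 G|) mulr_natr -sumr_const.
apply: eq_bigr => H; rewrite !inE => /andP[sHG /cyclicP[a defH]].
have Ga : a \in G by rewrite -cycle_subG -defH.
have gen_order x : generator <[a]> x -> #[x] = #[a].
  by rewrite /order => /eqP->.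
(* The summands over [H] are indexed by the generators of [H], and their weight
   depends only on the common order of these generators. *)
rewrite (eq_bigl (mem [set x | generator <[a]> x])) => [|x]; last first.
  rewrite inE /generator -val_eqE /= defH inE [in RHS]eq_sym andbC.
  by case: eqP => //= xa; rewrite -cycle_subG xa cycle_subG Ga.
rewrite (eq_bigr (fun _ => 3 + sign1 (a ^+ 2)%g)%R) => [|x]; last first.
  by rewrite !inE => /gen_order ox; rewrite /sign1 -!order_dvdn ox.
(* Remaining check: [totient d] times the weight is 4 for [d = 1, 2, 4]. *)
rewrite sumr_const -totient_gen /sign1 -order_dvdn.
have : #[a] %| 4 by rewrite order_dvdn expg4_eq1.
by move/(@dvdn_pfactor 2 _ 2 isT) => [[|[|[|k]]] // _ ->].
Qed.

(** [alpha G = 3/4] says [S(G) = 0] by the generator count, and [S(G)^2] is a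
    nonzero multiple of [S('Z(G))]. *)
Lemma alpha_eq34 :
  (alpha G == 3%:R / 4%:R)%R = (square_sum 'Z(G) == 0%R).
Proof.
have nzG : (#|G|%:Z != 0)%R by rewrite -lt0n.
have nzGq : (#|G|%:R != 0 :> rat)%R by rewrite pnatr_eq0 -lt0n.
have -> : (alpha G == 3%:R / 4%:R)%R = (square_sum G == 0%R).
  rewrite /alpha eqr_div // -!natrM eqr_nat.
  have := card_L1_square_sum; lia.
by rewrite -[LHS]orbb -mulf_eq0 square_sum_sqr mulf_eq0 (negPf nzG).
Qed.

End FrattiniOrder2.

Lemma square_sum_card2 A : #|A| = 2 -> square_sum A = 2%R.
Proof.
move=> oA; transitivity (#|A|%:R : int)%R; last by rewrite oA.
rewrite -sum1_card natr_sum; apply: eq_bigr => x Ax.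
have /eqP-> : x ^+ 2 == 1 by rewrite -order_dvdn -oA order_dvdG.
exact: sign1_1.
Qed.

(** Multiplying [x] by a generator changes the parity of its exponent, which
    decides whether [x ^+ 2 = 1]. *)
Lemma square_sum_cyclic4 A : cyclic A -> #|A| = 4 -> square_sum A = 0%R.
Proof.
case/cyclicP=> u defA; rewrite defA => ou.
apply: (@sum_flip_eq0 _ u); first exact: cycle_id.
move=> _ /cycleP[k ->]; rewrite -expgS -!expgM /sign1 -!order_dvdn [#[u]]ou.
have -> : (4 %| k.+1 * 2) = ~~ (4 %| k * 2) by lia.
by case: (4 %| k * 2).
Qed.

End SquareSums.

Theorem theorem3p3 :
  (~ exists (gT : finGroupType) (G : {group gT}),
       extraspecial2 G /\ alpha G = (3%:R / 4%:R)%R) /\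
  (forall (gT : finGroupType) (G : {group gT}),
       almost_extraspecial2 G -> alpha G = (3%:R / 4%:R)%R).
Proof.
split=> [[gT [G [[pG esG] /eqP]]] | gT G [pG _ isoPhi isoZ]].
  have oZ := card_center_extraspecial pG esG.
  have [[defPhi _] _] := esG.
  by rewrite alpha_eq34 ?defPhi // square_sum_card2.
apply/eqP; rewrite alpha_eq34 ?(card_isog isoPhi) ?card_Zp //.
rewrite square_sum_cyclic4 ?(card_isog isoZ) ?card_Zp //.
by rewrite (isog_cyclic isoZ); apply/cyclicP; exists Zp1; apply: Zp_cycle.
Qed.
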